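(* Let $\Delta t>0$ and let $(f^n,r^n)_{n\ge 0}$ be produced by the scheme SAV-1st: $r^0=\sqrt{H^0}$ and, for all $n\ge 0$, $$\frac{f^{n+1}-f^n}{\Delta t}=\frac{r^{n+1}}{\sqrt{H^n}}\,Q(f^n),\qquad \frac{r^{n+1}-r^n}{\Delta t}=\frac{1}{2\sqrt{H^n}}\int_\Omega \log f^n\,\frac{f^{n+1}-f^n}{\Delta t}\,dv,$$ where $H^n=H(f^n)=\int_\Omega f^n\log f^n\,dv+C>0$. Then for all $n\ge 0$ (and every step size $\Delta t>0$): (1) (conservation of mass, momentum and energy) $\displaystyle\int_\Omega f^{n+1}(1,v,|v|^2)^T\,dv=\int_\Omega f^n(1,v,|v|^2)^T\,dv$; (2) (modified entropy dissipation) with $\tilde H^n=(r^n)^2$, $$\tilde H^{n+1}-\tilde H^n=-(r^{n+1}-r^n)^2+\frac{\Delta t\,(r^{n+1})^2}{H^n}\int_\Omega Q(f^n)\log f^n\,dv\le 0.$$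
   Context: The scheme is a time discretization of the spatially homogeneous kinetic equation $\partial_t f=Q(f)$, $f=f(t,v)$. The velocity variable $v$ is kept continuous and ranges over a bounded (truncated) domain $\Omega\subset\mathbb{R}^d$; each $f^n$ is a real-valued function of $v\in\Omega$ and each $r^n$ is a real number. The collision operator $Q$ (mapping functions on $\Omega$ to functions on $\Omega$) is assumed to satisfy, for every function $f$ to which it is applied: - conservation: $\int_\Omega Q(f)\,dv=0$, $\int_\Omega Q(f)\,v\,dv=0$, $\int_\Omega Q(f)\,|v|^2\,dv=0$; - H-theorem: $\int_\Omega Q(f)\log f\,dv\le 0$. The constant $C$ is real and is chosen so that $H(f)=\int_\Omega f\log f\,dv+C$ is positive for the functions at which it is evaluated. In general $r^n\ne\sqrt{H^n}$ for $n>0$. It is a standing assumption that the functions inside logarithms are such that the logarithms are defined, and that all integrals appearing are well defined and finite. *)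

(* Defs.v *)
From HB Require Import structures.
From mathcomp Require Import all_boot all_order all_algebra.
From mathcomp Require Import all_classical all_reals all_analysis.

Set Implicit Arguments.
Unset Strict Implicit.
Unset Printing Implicit Defensive.

Import Order.TTheory GRing.Theory Num.Theory.
Import numFieldNormedType.Exports.

Local Open Scope classical_set_scope.
Local Open Scope ring_scope.

(* Points of R^d are d-tuples, which carry the Borel (product) sigma-algebra. *)
Definition velocity (R : realType) (d : nat) := d.-tuple (measurableTypeR R).

Section lebesgue_step.
Context (R : realType) (d : nat).
Variable mu : {sigma_finite_measure set (velocity R d) -> \bar R}.

Let vcons (p : measurableTypeR R * velocity R d) : velocity R d.+1 :=
  [tuple of p.1 :: p.2].

Let measurable_vcons : measurable_fun setT vcons.
Proof. exact: measurable_cons. Qed.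

(* Identifies R^(d+1) with R * R^d; lebesgue_measure is the library's measure
   on R. *)
Definition lebesgue_step : set (velocity R d.+1) -> \bar R :=
  pushforward (lebesgue_measure \x mu)%E vcons.

Let lebesgue_step0 : lebesgue_step set0 = 0%E.
Proof. by rewrite /lebesgue_step /pushforward preimage_set0 measure0. Qed.

Let lebesgue_step_ge0 A : (0 <= lebesgue_step A)%E.
Proof. exact: measure_ge0. Qed.

Let lebesgue_step_sigma_additive : semi_sigma_additive lebesgue_step.
Proof.
pose m : {measure set (velocity R d.+1) -> \bar R} :=
  measure_function_pushforward__canonical__measure_function_Measure
    (lebesgue_measure \x mu)%E measurable_vcons.
exact: (@measure_semi_sigma_additive _ _ _ m).
Qed.

HB.instance Definition _ := isMeasure.Build _ _ _ lebesgue_step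
  lebesgue_step0 lebesgue_step_ge0 lebesgue_step_sigma_additive.

Let vuncons (v : velocity R d.+1) : measurableTypeR R * velocity R d :=
  (thead v, [tuple of behead v]).

Let measurable_vuncons : measurable_fun setT vuncons.
Proof.
by apply/measurable_fun_pair; [exact: measurable_tnth|exact: measurable_behead].
Qed.

Let vconsK : cancel vcons vuncons.
Proof. by case=> x v; rewrite /vuncons theadE; congr pair; apply/val_inj. Qed.

Lemma lebesgue_stepE (A : set (measurableTypeR R)) (B : set (velocity R d)) :
  measurable A -> measurable B ->
  lebesgue_step (vuncons @^-1` (A `*` B)) = (lebesgue_measure A * mu B)%E.
Proof.
move=> mA mB; rewrite /lebesgue_step /pushforward -comp_preimage.
rewrite (_ : vuncons \o vcons = id) ?preimage_id ?product_measure1E//.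
by apply/funext => p; exact: vconsK.
Qed.

Let lebesgue_step_sigma_finite : sigma_finite setT lebesgue_step.
Proof.
have /sigma_finiteP[F [FT ndF Foo]] :=
  sigma_finiteT (@lebesgue_measure R : {sigma_finite_measure set _ -> \bar R}).
have /sigma_finiteP[G [GT ndG Goo]] := sigma_finiteT mu.
exists (fun n => vuncons @^-1` (F n `*` G n)).
  rewrite -preimage_bigcup -[LHS](preimage_setT vuncons); congr (_ @^-1` _).
  rewrite -setXTT FT GT; apply/seteqP; split=> -[x v] /=.
    move=> [[n _ Fnx] [k _ Gkv]]; exists (maxn n k) => //; split.
    - by move: x Fnx; exact/subsetPset/ndF/leq_maxl.
    - by move: v Gkv; exact/subsetPset/ndG/leq_maxr.
  by move=> [n _ []/= ? ?]; split; exists n.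
move=> n; have [mF Fn] := Foo n; have [mG Gn] := Goo n; split.
  by rewrite -[X in measurable X]setTI; apply: measurable_vuncons => //;
    exact: measurableX.
by rewrite lebesgue_stepE// lte_mul_pinfty// ge0_fin_numE.
Qed.

HB.instance Definition _ := Measure_isSigmaFinite.Build _ _ _ lebesgue_step
  lebesgue_step_sigma_finite.

End lebesgue_step.

Section lebesgue_velocity.
Context (R : realType).

Fixpoint lebesgue_velocity (d : nat) :
    {sigma_finite_measure set (velocity R d) -> \bar R} :=
  match d with
  | 0 => dirac ([tuple] : velocity R 0)
  | d'.+1 => lebesgue_step (lebesgue_velocity d')
  end.

Lemma lebesgue_velocity_box d (A : 'I_d -> set (measurableTypeR R)) :
  (forall i, measurable (A i)) ->
  lebesgue_velocity d [set v | forall i, A i (tnth v i)] =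
  (\prod_(i < d) lebesgue_measure (A i))%E.
Proof.
elim: d A => [|d IH] A mA.
  by rewrite big_ord0 /= diracE mem_set// => -[].
have mB : measurable [set v : velocity R d | forall i, A (lift ord0 i) (tnth v i)].
  rewrite (_ : [set _ | _] = \bigcap_(i in [set: 'I_d])
      ((fun v : velocity R d => tnth v i) @^-1` A (lift ord0 i))).
    apply: fin_bigcap_measurable => // i _.
    by rewrite -[X in measurable X]setTI; exact: measurable_tnth.
  by apply/seteqP; split=> v /= Av i; [move=> _|]; exact: Av.
rewrite big_ord_recl /= -(IH (fun i => A (lift ord0 i)))//.
rewrite -lebesgue_stepE//.
congr (lebesgue_step _ _); apply/seteqP; split=> v /=; case/tupleP: v => x v.
  move=> Av; split=> [|i]; first exact: Av ord0.
  set w := tnth _ i; rewrite (_ : w = tnth [tuple of x :: v] (lift ord0 i)).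
    exact: Av.
  by rewrite tnthS; congr tnth; exact/val_inj.
move=> [A0 Av] i; have [j ->|->//] := unliftP ord0 i.
have := Av j; set w := tnth _ j.
rewrite (_ : w = tnth [tuple of x :: v] (lift ord0 j))//.
by rewrite tnthS; congr tnth; exact/val_inj.
Qed.

End lebesgue_velocity.

Section collision.
Context (R : realType) (d : nat) (Omega : set (velocity R d)).

Notation mu := (lebesgue_velocity R d).

Definition coord (v : velocity R d) (i : 'I_d) : R := tnth v i.

Definition sqnorm (v : velocity R d) : R := \sum_(i < d) coord v i ^+ 2.

Definition bounded_domain : Prop :=
  measurable Omega /\ exists M : R, forall v, Omega v -> sqnorm v <= M.

(* Functions on Omega are represented by functions on R^d of which only the
   values on Omega are ever constrained.  D is the class of functions to which
   Q is applied: outside D nothing is assumed of Q. *)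
Implicit Types (f g : velocity R d -> R) (D : set (velocity R d -> R))
  (Q : (velocity R d -> R) -> (velocity R d -> R)).

Definition finite_integral g : Prop := mu.-integrable Omega (EFin \o g).

Definition finite_moments g : Prop :=
  [/\ finite_integral g,
      forall i, finite_integral (fun v => g v * coord v i)
    & finite_integral (fun v => g v * sqnorm v)].

Record well_defined D Q : Prop := WellDefined {
  density_gt0 : forall f, D f -> forall v, Omega v -> 0 < f v ;
  density_moments : forall f, D f -> finite_moments f ;
  density_entropy : forall f, D f -> finite_integral (fun v => f v * ln (f v)) ;
  collision_moments : forall f, D f -> finite_moments (Q f) ;
  collision_entropy :
    forall f, D f -> finite_integral (fun v => Q f v * ln (f v)) }.

Definition mass g : R := \int[mu]_(v in Omega) g v.

Definition momentum g (i : 'I_d) : R := \int[mu]_(v in Omega) (g v * coord v i).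

Definition energy g : R := \int[mu]_(v in Omega) (g v * sqnorm v).

Record conservative D Q : Prop := Conservative {
  collision_mass : forall f, D f -> mass (Q f) = 0 ;
  collision_momentum : forall f, D f -> forall i, momentum (Q f) i = 0 ;
  collision_energy : forall f, D f -> energy (Q f) = 0 }.

Definition entropy_production Q f : R :=
  \int[mu]_(v in Omega) (Q f v * ln (f v)).

Definition H_theorem D Q : Prop := forall f, D f -> entropy_production Q f <= 0.

Definition entropy (C : R) f : R :=
  \int[mu]_(v in Omega) (f v * ln (f v)) + C.

Record SAV1 (C : R) Q (dt : R) (f : nat -> velocity R d -> R) (r : nat -> R) :
    Prop := {
  SAV1_init : r 0 = Num.sqrt (entropy C (f 0)) ;
  SAV1_density : forall n v, Omega v ->
    (f n.+1 v - f n v) / dt =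
    r n.+1 / Num.sqrt (entropy C (f n)) * Q (f n) v ;
  SAV1_auxiliary : forall n,
    (r n.+1 - r n) / dt =
    1 / (2 * Num.sqrt (entropy C (f n))) *
      \int[mu]_(v in Omega) (ln (f n v) * ((f n.+1 v - f n v) / dt)) }.

End collision.

(* Main.v *)
Require Import Defs.
From HB Require Import structures.
From mathcomp Require Import all_boot all_order all_algebra.
From mathcomp Require Import all_classical all_reals all_analysis.
From mathcomp Require Import ring.

(** The density equation says f^{n+1} = f^n + c Q(f^n) on Omega, where
    c = dt r^{n+1} / sqrt H^n does not depend on the velocity.  Integrating
    it against the weights 1, v_i and |v|^2 therefore changes each moment of
    f^n by c times the corresponding moment of Q(f^n), which is zero.

    For the entropy, write P for the integral of Q(f^n) log f^n.  Substituting
    the density equation into the auxiliary one gives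
      2 (r^{n+1} - r^n) = dt (r^{n+1} / H^n) P:
    each equation contributes one factor 1 / sqrt H^n, so only H^n remains.
    Since r^{n+1} enters the density equation implicitly, multiplying by
    r^{n+1} makes the right side a nonnegative multiple of P whatever dt > 0
    is, and the identity
      2 a (a - b) = a^2 - b^2 + (a - b)^2
    gives the dissipation law; the H-theorem gives its sign. *)

Import Order.TTheory GRing.Theory Num.Theory.
Local Open Scope classical_set_scope.
Local Open Scope ring_scope.

Set Implicit Arguments.
Unset Strict Implicit.

(** Each moment of the scheme comes from this lemma: the increment c does not
    depend on the point, so it comes out of the integral of any weight phi. *)
Lemma Rintegral_increment_eq0 d (T : measurableType d) (R : realType)
    (mu : {measure set T -> \bar R}) (A : set T) (g h q phi : T -> R) (c : R) :
  measurable A ->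
  mu.-integrable A (EFin \o (fun x => g x * phi x)) ->
  mu.-integrable A (EFin \o (fun x => q x * phi x)) ->
  (forall x, A x -> h x = g x + c * q x) ->
  \int[mu]_(x in A) (q x * phi x) = 0 ->
  \int[mu]_(x in A) (h x * phi x) = \int[mu]_(x in A) (g x * phi x).
Proof.
move=> mA ig iq hE q0.
rewrite (@eq_Rintegral _ _ _ _ _ (fun x => g x * phi x + c * (q x * phi x))).
  rewrite RintegralD//; last exact: (integrableZl mA c iq).
  by rewrite RintegralZl// q0 mulr0 addr0.
by move=> x; rewrite inE => /hE ->; rewrite mulrDl mulrA.
Qed.

Section scheme.
Context (R : realType) (d : nat) (Omega : set (velocity R d))
  (D : set (velocity R d -> R))
  (Q : (velocity R d -> R) -> (velocity R d -> R))
  (C dt : R) (f : nat -> velocity R d -> R) (r : nat -> R).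
Context (mOmega : measurable Omega) (wdQ : well_defined Omega D Q)
  (dt_gt0 : 0 < dt) (Df : forall n, D (f n))
  (scheme : SAV1 Omega C Q dt f r).

Lemma SAV1_density_step n v : Omega v ->
  f n.+1 v =
  f n v + dt * (r n.+1 / Num.sqrt (entropy Omega C (f n))) * Q (f n) v.
Proof.
move=> Ov; rewrite -mulrA -(SAV1_density scheme n Ov).
by rewrite mulrC divfK ?gt_eqF// addrC subrK.
Qed.

Lemma SAV1_conservation n : conservative Omega D Q ->
  [/\ mass Omega (f n.+1) = mass Omega (f n),
      forall i, momentum Omega (f n.+1) i = momentum Omega (f n) i
    & energy Omega (f n.+1) = energy Omega (f n)].
Proof.
move=> [Qmass Qmom Qen].
have [f0 f1 f2] := density_moments wdQ (Df n).
have [q0 q1 q2] := collision_moments wdQ (Df n).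
split=> [|i|].
(* The mass is the moment of the constant weight 1. *)
- have mul1 (g : velocity R d -> R) : g = (fun v => g v * 1).
    by apply/funext => v; rewrite mulr1.
  rewrite /mass (mul1 (f n.+1)) (mul1 (f n)).
  apply: (Rintegral_increment_eq0 (phi := fun=> 1) mOmega _ _
    (@SAV1_density_step n)).
  + by rewrite -mul1; exact: f0.
  + by rewrite -mul1; exact: q0.
  + by rewrite -[X in Rintegral _ _ X]mul1; exact: Qmass.
- rewrite /momentum; apply: (Rintegral_increment_eq0 mOmega (f1 i) (q1 i)
    (@SAV1_density_step n)); exact: Qmom.
- rewrite /energy; apply: (Rintegral_increment_eq0 mOmega f2 q2
    (@SAV1_density_step n)); exact: Qen.
Qed.

(** This is the auxiliary equation with the density eliminated, hence a linear
    relation between r^{n+1} and r^n; its coefficient is rational in H^n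
    because both equations of the scheme carry the factor 1 / sqrt H^n. *)
Lemma SAV1_auxiliary_step n : 0 < entropy Omega C (f n) ->
  2 * (r n.+1 - r n) =
  dt * (r n.+1 / entropy Omega C (f n)) * entropy_production Omega Q (f n).
Proof.
move=> H_gt0; have := SAV1_auxiliary scheme n.
set H := entropy Omega C (f n); set s := Num.sqrt H.
have s_neq0 : s != 0 by rewrite gt_eqF// sqrtr_gt0.
have -> : H = s ^+ 2 by rewrite sqr_sqrtr// ltW.
rewrite (@eq_Rintegral _ _ _ _ _
  (fun v => r n.+1 / s * (Q (f n) v * ln (f n v)))); last first.
  move=> v; rewrite inE => Ov.
  by rewrite (SAV1_density scheme n Ov) mulrC mulrA.
rewrite RintegralZl//; last exact: (collision_entropy wdQ (Df n)).
rewrite -/(entropy_production Omega Q (f n)).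
move/(congr1 (fun x => x * dt)); rewrite divfK ?gt_eqF// => ->.
by field.
Qed.

Lemma SAV1_entropy_identity n : 0 < entropy Omega C (f n) ->
  r n.+1 ^+ 2 - r n ^+ 2 =
  - (r n.+1 - r n) ^+ 2 +
  dt * r n.+1 ^+ 2 / entropy Omega C (f n) *
    entropy_production Omega Q (f n).
Proof.
move=> /SAV1_auxiliary_step step.
have -> : r n.+1 ^+ 2 - r n ^+ 2 =
    - (r n.+1 - r n) ^+ 2 + r n.+1 * (2 * (r n.+1 - r n)) by ring.
by rewrite step; congr (_ + _); ring.
Qed.

End scheme.

Unset Implicit Arguments.
Set Strict Implicit.

Theorem theorem2p1 (R : realType) (d : nat) (Omega : set (velocity R d))
    (D : set (velocity R d -> R))
    (Q : (velocity R d -> R) -> (velocity R d -> R))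
    (C dt : R) (f : nat -> velocity R d -> R) (r : nat -> R) :
  bounded_domain Omega ->
  well_defined Omega D Q ->
  conservative Omega D Q ->
  H_theorem Omega D Q ->
  0 < dt ->
  (forall n, D (f n)) ->
  (forall n, 0 < entropy Omega C (f n)) ->
  SAV1 Omega C Q dt f r ->
  forall n,
    [/\ mass Omega (f n.+1) = mass Omega (f n),
        forall i, momentum Omega (f n.+1) i = momentum Omega (f n) i
      & energy Omega (f n.+1) = energy Omega (f n)] /\
    [/\ r n.+1 ^+ 2 - r n ^+ 2 =
          - (r n.+1 - r n) ^+ 2 +
          dt * r n.+1 ^+ 2 / entropy Omega C (f n) *
            entropy_production Omega Q (f n)
      & - (r n.+1 - r n) ^+ 2 +
          dt * r n.+1 ^+ 2 / entropy Omega C (f n) *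
            entropy_production Omega Q (f n) <= 0].
Proof.
move=> [mOmega _] wdQ consQ HQ dt_gt0 Df H_gt0 scheme n; split.
  exact: (SAV1_conservation mOmega wdQ dt_gt0 Df scheme).
split; first exact: (SAV1_entropy_identity mOmega wdQ dt_gt0 Df scheme).
rewrite -[leRHS]addr0; apply: lerD; first by rewrite oppr_le0 sqr_ge0.
apply: mulr_ge0_le0; last exact: HQ.
apply: divr_ge0; last exact: ltW.
by apply: mulr_ge0; [exact: ltW|exact: sqr_ge0].
Qed.
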